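(* Let $FL_1,FL_2,FL_3$ be the spaces defined in the context, with their natural actions of $\mathrm{SU}_3$. Then: (1) The spaces $FL_j$ $(j=1,2,3)$ are homogeneous under the natural action of $\mathrm{SU}_3$. (2) Each homogeneous space $FL_j$ $(j=1,2,3)$ can be represented as $FL_j=\mathrm{SU}_3/\mathrm U_1$, where $\mathrm U_1=\{\operatorname{diag}(a,a^{-1},1)\mid a\in S^1\}$ (that is, $\mathrm U_1$ is the stabilizer of a suitable point of $FL_j$). In particular they are all $7$-dimensional.
   Context: Let $e_1,e_2,e_3$ be the standard basis of $\mathbb C^3$, $\tilde e_1=(\frac{1+i}2,\frac{1-i}2,0)^T$, $\tilde e_2=(\frac{1-i}2,\frac{1+i}2,0)^T$, and let $V_0=\operatorname{span}_{\mathbb R}\{\tilde e_1,\tilde e_2,e_3\}$, an oriented real Lagrangian subspace of $\mathbb C^3$ with respect to the symplectic form $\operatorname{Im}\langle\cdot,\cdot\rangle$ ($\langle\cdot,\cdot\rangle$ the standard Hermitian product). The special Lagrangian Grassmannian $\mathrm{SL_{Gr}}(3,\mathbb C^3)$ is the $\mathrm{SU}_3$-orbit of $V_0$ in the set of oriented Lagrangian subspaces of $\mathbb C^3$; the stabilizer of $V_0$ is the connected subgroup $\mathrm{SO}_3\subset\mathrm{SU}_3$ with Lie algebra $\left\{\begin{pmatrix} ia&0&y\\0&-ia&\bar y\\-\bar y&-y&0\end{pmatrix}: a\in\mathbb R,\,y\in\mathbb C\right\}$. $FL_1=\{(v,V)\mid v\in S^5,\ v\in V,\ V\in \mathrm{SL_{Gr}}(3,\mathbb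 C^3)\}$, with action $g.(v,V)=(gv,gV)$. $FL_2$ is the set of pairs $(w,\mathcal W)$ where $w\in S^5$ and $\mathcal W=(0\subset W_1\subset W_2\subset W_3=\mathbb C^3)$ is a full flag of complex subspaces, $\dim_{\mathbb C}W_j=j$, with $W_1=\mathbb Cw$; action $g.(w,\mathcal W)=(gw,g\mathcal W)$. $FL_3=\{UPU^T\mid U\in\mathrm{SU}_3\}$ with $P=\begin{pmatrix}0&\epsilon^2&0\\ \epsilon^4&0&0\\0&0&1\end{pmatrix}$, $\epsilon=e^{\pi i/3}$; action $g.Q=gQg^T$. *)

(* Defs.v *)
From HB Require Import structures.
From mathcomp Require Import all_boot all_order all_algebra.
From mathcomp Require Import spectral complex.
From mathcomp Require Import all_classical all_reals all_analysis.
Import numFieldNormedType.Exports.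
Set Implicit Arguments.
Unset Strict Implicit.
Unset Printing Implicit Defensive.
Import Order.TTheory GRing.Theory Num.Theory.
Local Open Scope classical_set_scope.
Local Open Scope complex_scope.
Local Open Scope ring_scope.

Section Groups.
Variable R : realType.

Definition SU3 : set 'M[R[i]]_3 := [set g | g \is unitarymx /\ \det g = 1].

Definition U1 : set 'M[R[i]]_3 :=
  [set g | exists2 a : R[i], `|a| = 1 &
           g = diag_mx (\row_(j < 3) [:: a; a^-1; 1]`_j)].

End Groups.

Section HomogeneousSpaces.
Variables (R : realType) (X : Type) (act : 'M[R[i]]_3 -> X -> X) (F : set X).

Definition homogeneous : Prop :=
  [/\ F !=set0,
      forall g x, SU3 g -> F x -> F (act g x),
      forall x, F x -> act 1 x = x,
      forall g h x, SU3 g -> SU3 h -> F x -> act (g *m h) x = act g (act h x) &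
      forall x y, F x -> F y -> exists2 g, SU3 g & act g x = y].

Definition stabilizer (x : X) : set 'M[R[i]]_3 :=
  [set g | SU3 g /\ act g x = x].

(* The topology of F as a homogeneous space: the quotient topology of the orbit
   maps g |-> act g x from SU3, which carries the subspace topology of M_3(C).
   When the action on F is transitive it does not depend on x, since right
   translations are homeomorphisms of SU3.  The regular algebra R[i]^o is what
   carries the norm topology of R[i]. *)
Definition orbit_open (A : set X) : Prop :=
  A `<=` F /\
  forall x, F x ->
    exists2 O : set 'M[(R[i])^o]_3,
      open O & O `&` @SU3 R = [set g | A (act g x)] `&` @SU3 R.

(* n-dimensional: each point has an open neighbourhood phi @` D homeomorphic,
   through phi, to an open set D of R^n; taking E = D in the last clause, phi @` D
   is itself open. *)
Definition has_dimension (n : nat) : Prop :=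
  forall x, F x ->
    exists (D : set 'rV[R]_n) (phi : 'rV[R]_n -> X),
      [/\ open D, set_inj D phi, phi @` D `<=` F, (phi @` D) x &
          forall E : set 'rV[R]_n, E `<=` D -> (open E <-> orbit_open (phi @` E))].

End HomogeneousSpaces.

Section Spaces.
Variable R : realType.

Definition hdot (u v : 'cV[R[i]]_3) : R[i] := \sum_j u j 0 * Num.conj (v j 0).

Definition S5 : set 'cV[R[i]]_3 := [set v | hdot v v = 1].

(* Only meaningful when carrier is a real subspace and positive_frames is an
   orientation of it, i.e. a class of bases (given as the columns of a matrix)
   under changes of basis of positive determinant; see oriented_lagrangian. *)
Record oriented_subspace := OrientedSubspace {
  carrier : set 'cV[R[i]]_3;
  positive_frames : set 'M[R[i]]_3 }.

Definition real_free (B : 'M[R[i]]_3) : Prop :=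
  injective (fun c : 'cV[R]_3 => B *m map_mx (real_complex R) c).

(* The real span of the columns of B, oriented by that ordered basis. *)
Definition oriented_span (B : 'M[R[i]]_3) : oriented_subspace :=
  OrientedSubspace
    [set B *m map_mx (real_complex R) c | c in [set: 'cV[R]_3]]
    [set B *m map_mx (real_complex R) A | A in [set A : 'M[R]_3 | 0 < \det A]].

Definition oriented_lagrangian (V : oriented_subspace) : Prop :=
  (exists2 B, real_free B & V = oriented_span B) /\
  (forall u v, carrier V u -> carrier V v -> complex.Im (hdot u v) = 0).

Definition oact (g : 'M[R[i]]_3) (V : oriented_subspace) : oriented_subspace :=
  OrientedSubspace [set g *m v | v in carrier V]
                   [set g *m B | B in positive_frames V].

Definition te1 : 'cV[R[i]]_3 := \col_j [:: 2^-1 +i* 2^-1; 2^-1 -i* 2^-1; 0]`_j.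
Definition te2 : 'cV[R[i]]_3 := \col_j [:: 2^-1 -i* 2^-1; 2^-1 +i* 2^-1; 0]`_j.
Definition e3 : 'cV[R[i]]_3 := \col_j [:: 0; 0; 1]`_j.

Definition V0 : oriented_subspace :=
  oriented_span (\matrix_(j, k) [:: te1; te2; e3]`_k j 0).

Definition SLGr : set oriented_subspace :=
  [set V | oriented_lagrangian V /\ exists2 g, SU3 g & V = oact g V0].

Definition FL1 : set ('cV[R[i]]_3 * oriented_subspace) :=
  [set p | [/\ S5 p.1, carrier p.2 p.1 & SLGr p.2]].

Definition act1 (g : 'M[R[i]]_3) (p : 'cV[R[i]]_3 * oriented_subspace) :=
  (g *m p.1, oact g p.2).

Record flag := Flag {
  W1 : {vspace 'cV[R[i]]_3};
  W2 : {vspace 'cV[R[i]]_3};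
  W3 : {vspace 'cV[R[i]]_3} }.

Definition full_flag (W : flag) : Prop :=
  [/\ (W1 W <= W2 W)%VS, (W2 W <= W3 W)%VS, W3 W = fullv &
      [/\ \dim (W1 W) = 1%N, \dim (W2 W) = 2%N & \dim (W3 W) = 3%N]].

Definition flag_act (g : 'M[R[i]]_3) (W : flag) : flag :=
  Flag (linfun (mulmx g) @: W1 W) (linfun (mulmx g) @: W2 W)
       (linfun (mulmx g) @: W3 W).

Definition FL2 : set ('cV[R[i]]_3 * flag) :=
  [set p | [/\ S5 p.1, full_flag p.2 & W1 p.2 = <[p.1]>%VS]].

Definition act2 (g : 'M[R[i]]_3) (p : 'cV[R[i]]_3 * flag) :=
  (g *m p.1, flag_act g p.2).

(* exp (pi * i / 3) *)
Definition epsilon : R[i] := cos (pi / 3) +i* sin (pi / 3).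

Definition P : 'M[R[i]]_3 :=
  \matrix_(j, k) (nth [::] [:: [:: 0; epsilon ^+ 2; 0];
                               [:: epsilon ^+ 4; 0; 0];
                               [:: 0; 0; 1]] j)`_k.

Definition FL3 : set 'M[R[i]]_3 := [set U *m P *m U^T | U in @SU3 R].

Definition act3 (g Q : 'M[R[i]]_3) : 'M[R[i]]_3 := g *m Q *m g^T.

End Spaces.

Arguments SU3 {R}.
Arguments U1 {R}.
Arguments FL1 {R}.
Arguments FL2 {R}.
Arguments FL3 {R}.
Arguments act1 {R}.
Arguments act2 {R}.
Arguments act3 {R}.

(* Main.v *)
Require Import Defs.
From mathcomp Require Import all_boot all_order all_algebra.
From mathcomp Require Import spectral complex ring lra.
From mathcomp Require Import all_classical all_reals all_analysis.

(** The stabilizers of (e3, V0), of (e3, <e3> < <e3, e1> < C^3) and of P all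
    equal U1, so each FL_j is the homogeneous space SU3/U1.  The coset g U1
    determines the last column w of g and, since U1 rescales the first column v,
    the line spanned by v; conversely v and w give the middle column as the
    conjugate of the cross product of w and v.  Near the base point a coset is
    therefore parametrized by five real coordinates of w in S^5 (all but the
    positive real part of w_2) and by the complex slope v_1 / v_0 of a line
    orthogonal to w.  Both this chart and its inverse are given by explicit
    continuous formulas, and left translations carry it to every point. *)

Import numFieldNormedType.Exports.
Set Implicit Arguments.
Unset Strict Implicit.
Unset Printing Implicit Defensive.
Import Order.TTheory GRing.Theory Num.Theory.
Local Open Scope classical_set_scope.
Local Open Scope complex_scope.
Local Open Scope ring_scope.

(** * Limits of complex-valued functions *)

Section ComplexTopology.
Variables (R : realType) (T : Type) (F : set_system T).
Context {FF : Filter F}.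
Local Notation C := (R[i])^o.

Lemma cvg_real_complex (f : T -> R) (a : R) :
  f @ F --> a -> (fun x => (f x)%:C : C) @ F --> (a%:C : C).
Proof.
move=> fa; apply/cvgrPdist_lt => e e0.
(* In the order of [R[i]] a positive element is real, so the radius [e] comes from [R]. *)
have [re e_re] : exists r, e = r%:C by apply/complex_realP/gtr0_real.
move: e0; rewrite e_re ltcR => re0.
move/cvgrPdist_lt : fa => /(_ _ re0); apply: filterS => x.
by rewrite -rmorphB /= normc_def /= expr0n /= addr0 sqrtr_sqr ltcR.
Qed.

Lemma cvg_complex (f g : T -> R) (a b : R) :
  f @ F --> a -> g @ F --> b ->
  (fun x => f x +i* g x : C) @ F --> (a +i* b : C).
Proof.
move=> fa gb.
have E (x y : R) : x +i* y = x%:C + 'i * y%:C :> R[i] by simpc.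
rewrite E; under eq_fun do rewrite E.
apply: cvgD; first exact: cvg_real_complex.
by apply: cvgM; [exact: cvg_cst|exact: cvg_real_complex].
Qed.

Lemma cvg_Re (f : T -> C) (a : C) :
  f @ F --> a -> (fun x => complex.Re (f x)) @ F --> complex.Re a.
Proof.
move=> /cvgrPdist_lt fa; apply/cvgrPdist_lt => e e0.
have e0C : 0 < e%:C by rewrite ltcR.
apply: filterS (fa _ e0C) => x; rewrite -raddfB.
by move/(le_lt_trans (normc_ge_Re _)); rewrite ltcR.
Qed.

Lemma cvg_conj (f : T -> C) (a : C) :
  f @ F --> a -> (fun x => Num.conj (f x) : C) @ F --> (Num.conj a : C).
Proof.
move=> /cvgrPdist_lt fa; apply/cvgrPdist_lt => e e0.
by apply: filterS (fa _ e0) => x; rewrite -rmorphB norm_conjC.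
Qed.

Lemma cvg_Im (f : T -> C) (a : C) :
  f @ F --> a -> (fun x => complex.Im (f x)) @ F --> complex.Im a.
Proof.
move=> /cvgrPdist_lt fa; apply/cvgrPdist_lt => e e0.
have e0C : 0 < e%:C by rewrite ltcR.
apply: filterS (fa _ e0C) => x; rewrite -raddfB /=.
rewrite -[complex.Im _]opprK -ReiNIm normrN -[X in X < _]mulr1 -(normCi R[i]).
by rewrite -normrM; move/(le_lt_trans (normc_ge_Re _)); rewrite ltcR.
Qed.
End ComplexTopology.

(** * Orthonormal frames in dimension three *)

Local Notation o0 := (@Ordinal 3 0 isT).
Local Notation o1 := (@Ordinal 3 1 isT).
Local Notation o2 := (@Ordinal 3 2 isT).

Lemma ord3P (Q : 'I_3 -> Prop) : Q o0 -> Q o1 -> Q o2 -> forall i, Q i.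
Proof.
move=> Q0 Q1 Q2 [[|[|[|//]]] p].
- by rewrite (_ : Ordinal p = o0) //; apply: val_inj.
- by rewrite (_ : Ordinal p = o1) //; apply: val_inj.
- by rewrite (_ : Ordinal p = o2) //; apply: val_inj.
Qed.

Lemma sum3 (V : nmodType) (F : 'I_3 -> V) : \sum_i F i = F o0 + F o1 + F o2.
Proof.
rewrite 2!big_ord_recr /= big_ord1.
by congr (F _ + F _ + F _); apply: val_inj.
Qed.

Lemma det3 (K : comNzRingType) (A : 'M[K]_3) :
  \det A = A o0 o0 * (A o1 o1 * A o2 o2 - A o1 o2 * A o2 o1)
         - A o0 o1 * (A o1 o0 * A o2 o2 - A o1 o2 * A o2 o0)
         + A o0 o2 * (A o1 o0 * A o2 o1 - A o1 o1 * A o2 o0).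
Proof.
(* Indexing the entries by natural numbers lets the nested lifts produced by the two expansions
   compute, so that [ring] recognizes equal entries. *)
pose a m n := A (inord m) (inord n).
have aE i j : A i j = a (val i) (val j) by rewrite /a !inord_val.
rewrite !(expand_det_row _ ord0) !big_ord_recl !big_ord0.
rewrite /cofactor !(expand_det_row _ ord0) !big_ord_recl !big_ord0.
rewrite /cofactor !det_mx11 !mxE !aE /= /bump /=.
by ring.
Qed.

Section Frame.
Variables (K : comNzRingType) (c : {rmorphism K -> K}) (v w : 'cV[K]_3).
Hypothesis cK : involutive c.

Definition cross (i : 'I_3) : K :=
  [:: w o1 0 * v o2 0 - w o2 0 * v o1 0;
      w o2 0 * v o0 0 - w o0 0 * v o2 0;
      w o0 0 * v o1 0 - w o1 0 * v o0 0]`_i.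

(** The abstract involution [c] makes one construction serve twice: with conjugation it yields
    elements of SU3, with the identity of [R] it yields rotations in [real_frame]. *)
Definition frame : 'M[K]_3 :=
  \matrix_(i, j) [:: v i 0; c (cross i); w i 0]`_j.

Hypothesis v1 : \sum_i v i 0 * c (v i 0) = 1.
Hypothesis w1 : \sum_i w i 0 * c (w i 0) = 1.
Hypothesis vw : \sum_i v i 0 * c (w i 0) = 0.

Let wv : \sum_i w i 0 * c (v i 0) = 0.
Proof.
rewrite -[RHS](rmorph0 c) -[in RHS]vw rmorph_sum /=; apply: eq_bigr => i _.
by rewrite rmorphM cK mulrC.
Qed.

(** Lagrange's identity: the square norm of w x v is |v|^2 |w|^2 - |<v, w>|^2. *)
Lemma cross_norm : \sum_i cross i * c (cross i) = 1.
Proof.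
transitivity ((\sum_i v i 0 * c (v i 0)) * (\sum_i w i 0 * c (w i 0))
  - (\sum_i v i 0 * c (w i 0)) * (\sum_i w i 0 * c (v i 0))).
  by rewrite !sum3 /cross /= !(rmorphM, rmorphB); ring.
by rewrite v1 w1 vw mul0r subr0 mulr1.
Qed.

(** Along the middle column the cofactors are the entries of [cross], so the determinant is the
    square norm of the cross product. *)
Lemma det_frame : \det frame = 1.
Proof. by rewrite -cross_norm sum3 det3 !mxE /cross /=; ring. Qed.

Lemma frame_unitary : frame *m map_mx c frame^T = 1%:M.
Proof.
(* Swapping the factors turns the goal into orthonormality of the columns. The products of v and w
   with the cross product vanish identically, as determinants with a repeated column. *)
apply: mulmx1C; apply/matrixP; apply: ord3P; apply: ord3P.
all: rewrite !mxE sum3 !mxE /= ?cK.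
- by rewrite -v1 sum3; ring.
- by rewrite -!rmorphM -!rmorphD -[RHS](rmorph0 c) /cross /=; congr (c _); ring.
- by apply: etrans wv; rewrite sum3; ring.
- by rewrite /cross /=; ring.
- by rewrite -cross_norm sum3; ring.
- by rewrite /cross /=; ring.
- by apply: etrans vw; rewrite sum3; ring.
- by rewrite -!rmorphM -!rmorphD -[RHS](rmorph0 c) /cross /=; congr (c _); ring.
- by rewrite -w1 sum3; ring.
Qed.

End Frame.
(** * SU3 and its subgroup U1 *)

Section SpecialUnitary.
Variable R : realType.
Implicit Types g h k u : 'M[R[i]]_3.

Definition adj g : 'M[R[i]]_3 := map_mx Num.conj g^T.

Lemma mulmx_adj g : SU3 g -> g *m adj g = 1%:M.
Proof. by case=> /unitarymxP. Qed.

Lemma mul_adj_mx g : SU3 g -> adj g *m g = 1%:M.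
Proof. by move/mulmx_adj/mulmx1C. Qed.

Lemma SU3_1 : SU3 (1%:M : 'M[R[i]]_3).
Proof. by split; [apply/unitarymxP; rewrite trmx1 map_mx1 mulmx1|rewrite det1]. Qed.

Lemma SU3_mul g h : SU3 g -> SU3 h -> SU3 (g *m h).
Proof.
by move=> [gU g1] [hU h1]; split; [exact: mul_unitarymx|rewrite det_mulmx g1 h1 mulr1].
Qed.

Lemma SU3_adj g : SU3 g -> SU3 (adj g).
Proof.
move=> [gU g1]; split; first by rewrite trmxC_unitary.
by rewrite /adj det_map_mx det_tr g1 rmorph1.
Qed.

Lemma SU3_rows g i j : SU3 g ->
  \sum_k g i k * Num.conj (g j k) = (i == j)%:R.
Proof.
move/mulmx_adj/matrixP/(_ i j); rewrite !mxE => <-.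
by apply: eq_bigr => k _; rewrite !mxE.
Qed.

Lemma SU3_cols g i j : SU3 g ->
  \sum_k Num.conj (g k i) * g k j = (i == j)%:R.
Proof.
move/mul_adj_mx/matrixP/(_ i j); rewrite !mxE => <-.
by apply: eq_bigr => k _; rewrite !mxE.
Qed.

Lemma SU3I g : g *m adj g = 1%:M -> \det g = 1 -> SU3 g.
Proof. by move=> /unitarymxP. Qed.

Lemma adjM g h : adj (g *m h) = adj h *m adj g.
Proof. by rewrite /adj trmx_mul map_mxM. Qed.

Lemma adjK : involutive adj.
Proof. by move=> g; apply/matrixP => i j; rewrite !mxE conjCK. Qed.

Lemma U1_entries u : U1 u ->
  exists2 a : R[i], `|a| = 1 &
    u = \matrix_(i, j)
      (nth [::] [:: [:: a; 0; 0]; [:: 0; a^-1; 0]; [:: 0; 0; 1]] i)`_j.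
Proof.
case=> a a1 ->; exists a => //; apply/matrixP; apply: ord3P; apply: ord3P;
  by rewrite !mxE.
Qed.

Lemma U1_SU3 u : U1 u -> SU3 u.
Proof.
move=> /U1_entries[a a1 uE].
have a0 : a != 0 by rewrite -normr_gt0 a1.
have ac : a * Num.conj a = 1 by rewrite -normCK a1 expr1n.
have aV : a^-1 = Num.conj a by apply: (mulfI a0); rewrite divff.
split; last by rewrite det3 uE !mxE /= !mulr1 !mulr0 !mul0r !subr0 addr0 divff.
apply/unitarymxP; apply/matrixP; apply: ord3P; apply: ord3P.
all: rewrite !mxE sum3 !mxE uE !mxE /= ?aV ?conjCK ?rmorph0 ?rmorph1 ?mulr0 ?mul0r.
all: by rewrite ?addr0 ?add0r ?mulr1 // mulrC.
Qed.

Lemma sqnorm_sum_eq0 (x y : R[i]) :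
  x * Num.conj x + y * Num.conj y = 0 -> x = 0 /\ y = 0.
Proof.
rewrite -!normCK => /eqP; rewrite paddr_eq0 ?exprn_ge0 //.
by rewrite !expf_eq0 /= !normr_eq0 => /andP[/eqP-> /eqP->].
Qed.

(** Unit rows and columns do the rest: the last row kills [k20] and [k21], the first column then
    gives |k00| = 1, the first row kills [k01], and the determinant makes [k11] the inverse of
    [k00]. *)
Lemma U1P k : SU3 k -> k o0 o2 = 0 -> k o1 o2 = 0 -> k o2 o2 = 1 ->
  k o1 o0 = 0 -> U1 k.
Proof.
move=> Sk k02 k12 k22 k10.
have [k20 k21] : k o2 o0 = 0 /\ k o2 o1 = 0.
  apply: sqnorm_sum_eq0; have := SU3_rows o2 o2 Sk.
  by rewrite sum3 k22 /= rmorph1 mulr1 => /(canRL (addrK _)); rewrite subrr.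
have k00 : k o0 o0 * Num.conj (k o0 o0) = 1.
  have := SU3_cols o0 o0 Sk.
  by rewrite sum3 k10 k20 !mulr0 !addr0 mulrC.
have k01 : k o0 o1 = 0.
  have [//] : k o0 o1 = 0 /\ k o0 o2 = 0.
  apply: sqnorm_sum_eq0; have := SU3_rows o0 o0 Sk.
  by rewrite sum3 k00 -addrA => /(canRL (addKr _)); rewrite addNr.
have kd : k o0 o0 * k o1 o1 = 1.
  by case: Sk => _ <-; rewrite det3 k02 k12 k22 k01; ring.
have k00_neq0 : k o0 o0 != 0.
  by apply: contra_eq_neq kd => ->; rewrite mul0r eq_sym oner_eq0.
exists (k o0 o0).
  by apply/eqP; rewrite -(@eqrXn2 _ 2) // normCK k00 expr1n.
apply/matrixP; apply: ord3P; apply: ord3P; rewrite !mxE //=.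
by rewrite mulr1n; apply: (mulfI k00_neq0); rewrite divff.
Qed.

(** The entries of [adj h *m g] are Hermitian products of columns of [h] with columns of [g].
    Replacing the first and last columns of [g] by those of [h] makes them the entries that [U1P]
    asks for. *)
Lemma U1_coset g h a : SU3 g -> SU3 h ->
  (forall i, g i o2 = h i o2) -> (forall i, g i o0 = a * h i o0) ->
  exists2 u, U1 u & g = h *m u.
Proof.
move=> Sg Sh gh2 gh0; exists (adj h *m g); last first.
  by rewrite mulmxA mulmx_adj // mul1mx.
have E2 i : (adj h *m g) i o2 = (i == o2)%:R.
  rewrite -(SU3_cols _ _ Sh) mxE; apply: eq_bigr => k _.
  by rewrite !mxE gh2.
apply: U1P; rewrite ?E2 //; first by apply: SU3_mul => //; exact: SU3_adj.
transitivity (a * (o1 == o0)%:R); last by rewrite mulr0.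
rewrite -(SU3_cols o1 o0 Sh) mxE mulr_sumr; apply: eq_bigr => k _.
by rewrite !mxE gh0 mulrCA.
Qed.

End SpecialUnitary.

(** * A chart of SU3/U1 at the base point *)

Section Chart.
Variable R : realType.
Local Notation C := (R[i]).
Implicit Types (d : 'rV[R]_7) (g : 'M[C]_3).

Definition crd d (k : nat) : R := d 0 (inord k).

Definition radicand d : R :=
  1 - (crd d 0 ^+ 2 + crd d 1 ^+ 2 + crd d 2 ^+ 2 + crd d 3 ^+ 2 + crd d 4 ^+ 2).

(** The product of the open unit ball of R^5 with the plane R^2. *)
Definition chart_dom : set 'rV[R]_7 := [set d | 0 < radicand d].

Definition chart_w d : 'cV[C]_3 :=
  \col_i [:: crd d 0 +i* crd d 1; crd d 2 +i* crd d 3;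
             Num.sqrt (radicand d) +i* crd d 4]`_i.

Definition chart_slope d : C := crd d 5 +i* crd d 6.

(* The last entry makes this vector orthogonal to chart_w d. *)
Definition chart_dir d : 'cV[C]_3 :=
  \col_i [:: 1; chart_slope d;
             - (Num.conj (chart_w d o0 0) + chart_slope d * Num.conj (chart_w d o1 0))
             / Num.conj (chart_w d o2 0)]`_i.

(** The Hermitian norm of [chart_dir d]. The sum is real, and [Re] only moves it to [R], where the
    square root is known to be continuous. *)
Definition chart_nrm d : C :=
  (Num.sqrt (complex.Re (\sum_i chart_dir d i 0 * Num.conj (chart_dir d i 0))))%:C.

Definition chart_v d : 'cV[C]_3 := \col_i (chart_dir d i 0 / chart_nrm d).

Definition chart d : 'M[C]_3 := frame Num.conj (chart_v d) (chart_w d).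

Definition coords_dom : set 'M[C]_3 :=
  [set g | 0 < complex.Re (g o2 o2) /\ g o0 o0 != 0].

Definition coords g : 'rV[R]_7 :=
  \row_k [:: complex.Re (g o0 o2); complex.Im (g o0 o2);
             complex.Re (g o1 o2); complex.Im (g o1 o2); complex.Im (g o2 o2);
             complex.Re (g o1 o0 / g o0 o0); complex.Im (g o1 o0 / g o0 o0)]`_k.

Lemma crdE d (k : 'I_7) : d 0 k = crd d k.
Proof. by rewrite /crd inord_val. Qed.

Lemma crd_coords g k : (k < 7)%N -> crd (coords g) k =
  [:: complex.Re (g o0 o2); complex.Im (g o0 o2);
      complex.Re (g o1 o2); complex.Im (g o1 o2); complex.Im (g o2 o2);
      complex.Re (g o1 o0 / g o0 o0); complex.Im (g o1 o0 / g o0 o0)]`_k.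
Proof. by move=> k7; rewrite /crd mxE inordK. Qed.

Lemma mulcJ (x y : R) :
  (x +i* y) * Num.conj (x +i* y : C) = (x ^+ 2 + y ^+ 2)%:C.
Proof. by rewrite -normCK -add_Re2_Im2. Qed.

Lemma complex_eta (z : C) : complex.Re z +i* complex.Im z = z.
Proof. by case: z. Qed.

Lemma chart_w_unit d : chart_dom d ->
  \sum_i chart_w d i 0 * Num.conj (chart_w d i 0) = 1.
Proof.
move=> d0; rewrite sum3 !mxE /= !mulcJ sqr_sqrtr ?ltW //.
rewrite -!rmorphD -(rmorph1 (real_complex R)).
by congr (_%:C); rewrite /radicand; ring.
Qed.

Lemma chart_w2_neq0 d : chart_dom d -> chart_w d o2 0 != 0.
Proof. by move=> d0; rewrite mxE eq_complex /= gt_eqF // sqrtr_gt0. Qed.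

(** The first entry of [chart_dir d] is 1, hence the square norm is at least 1. *)
Lemma chart_dir_sqnorm d :
  \sum_i chart_dir d i 0 * Num.conj (chart_dir d i 0) = chart_nrm d ^+ 2
  /\ chart_nrm d != 0.
Proof.
rewrite /chart_nrm; set S := \sum_i _.
have S1 : 1 <= S.
  rewrite /S sum3 [chart_dir d o0 0]mxE /= rmorph1 mulr1 -addrA lerDl.
  by rewrite addr_ge0 // -normCK exprn_ge0.
have SR : (complex.Re S)%:C = S by apply/RRe_real/gtr0_real/(lt_le_trans _ S1).
have S0 : 0 < complex.Re S by rewrite -ltcR SR (lt_le_trans _ S1).
rewrite -rmorphXn /= sqr_sqrtr ?ltW // SR; split => //.
by rewrite -(rmorph0 (real_complex R)) (inj_eq (@complexI R)) gt_eqF // sqrtr_gt0.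
Qed.

Lemma chart_v_unit d : \sum_i chart_v d i 0 * Num.conj (chart_v d i 0) = 1.
Proof.
have [Sn n0] := chart_dir_sqnorm d.
have conj_divn (x : C) : Num.conj (x / chart_nrm d) = Num.conj x / chart_nrm d.
  by rewrite rmorphM fmorphV; congr (_ / _); exact: conjc_real.
transitivity ((\sum_i chart_dir d i 0 * Num.conj (chart_dir d i 0)) / chart_nrm d ^+ 2).
  rewrite mulr_suml; apply: eq_bigr => i _.
  by rewrite ![chart_v d _ _]mxE conj_divn; field.
by rewrite Sn divff // sqrf_eq0.
Qed.

Lemma chart_v_orth d : chart_dom d ->
  \sum_i chart_v d i 0 * Num.conj (chart_w d i 0) = 0.
Proof.
move=> /chart_w2_neq0; rewrite -(fmorph_eq0 Num.conj) => w20.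
have [_ n0] := chart_dir_sqnorm d.
rewrite sum3 ![chart_v _ _ _]mxE ![chart_dir _ _ _]mxE /=.
by field; rewrite n0 w20.
Qed.

Lemma chart_SU3 d : chart_dom d -> SU3 (chart d).
Proof.
move=> d0; have [[wu vu] vw] := (chart_w_unit d0, chart_v_unit d, chart_v_orth d0).
split; last exact: (det_frame vu wu vw).
by apply/unitarymxP; apply: (frame_unitary _ vu wu vw); exact: conjCK.
Qed.

Lemma chart0 d i : chart d i o0 = chart_v d i 0.
Proof. by rewrite mxE. Qed.

Lemma chart2 d i : chart d i o2 = chart_w d i 0.
Proof. by rewrite mxE. Qed.

Lemma chart_slopeE d : chart d o1 o0 / chart d o0 o0 = chart_slope d.
Proof.
have [_ n0] := chart_dir_sqnorm d.
by rewrite !chart0 !mxE /=; field.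
Qed.

Lemma chart_coords_dom d : chart_dom d -> coords_dom (chart d).
Proof.
move=> d0; split; first by rewrite chart2 mxE /= sqrtr_gt0.
have [_ n0] := chart_dir_sqnorm d.
by rewrite chart0 !mxE /= mul1r invr_eq0.
Qed.

(** [coords] reads everything in the last column except Re w_2, which is where the square root sits,
    and the norm cancels in the slope. *)
Lemma chartK d : coords (chart d) = d.
Proof.
apply/rowP => k; rewrite !crdE crd_coords // chart_slopeE !chart2 !mxE.
by case: k => [[|[|[|[|[|[|[|]]]]]]] ?].
Qed.

Lemma coords_U1 g u : U1 u -> coords_dom g ->
  coords_dom (g *m u) /\ coords (g *m u) = coords g.
Proof.
move=> /U1_entries[a a1 ->] [g22 g00].
set u' := \matrix_(i, j) _; have a0 : a != 0 by rewrite -normr_gt0 a1.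
have E2 i : (g *m u') i o2 = g i o2.
  by rewrite mxE sum3 !mxE /= !mulr0 !add0r mulr1.
have E0 i : (g *m u') i o0 = g i o0 * a.
  by rewrite mxE sum3 !mxE /= !mulr0 !addr0.
split; first by split; [rewrite E2|rewrite E0 mulf_neq0].
by apply/rowP => k; rewrite [LHS]mxE [RHS]mxE !E2 !E0 -mulf_div divff // mulr1.
Qed.

Lemma coordsK g : SU3 g -> coords_dom g ->
  chart_dom (coords g) /\ exists2 u, U1 u & g = chart (coords g) *m u.
Proof.
move=> Sg [g22 g00].
(* The last column is a unit vector, so [radicand] is the square of Re g22; as Re g22 is positive,
   the square root gives it back. *)
have gr : radicand (coords g) = complex.Re (g o2 o2) ^+ 2.
  have /(congr1 (@complex.Re R)) := SU3_cols o2 o2 Sg.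
  rewrite sum3 !(mulrC (Num.conj _)) -!normCK -!add_Re2_Im2 -!rmorphD /= => H.
  by rewrite /radicand !crd_coords //=; lra.
have gd : chart_dom (coords g) by rewrite /chart_dom /= gr exprn_gt0.
split => //.
have E2 i : g i o2 = chart_w (coords g) i 0.
  rewrite mxE gr !crd_coords //= sqrtr_sqr gtr0_norm // !complex_eta.
  by move: i; apply: ord3P.
(* The first column of the chart is (1, slope, _) divided by [chart_nrm]; multiplying by that norm
   and by g00 restores the first two entries of [g]. *)
apply: (@U1_coset _ _ _ (g o0 o0 * chart_nrm (coords g))) => //.
- exact: chart_SU3.
- by move=> i; rewrite chart2.
- have [_ n0] := chart_dir_sqnorm (coords g).
  move=> i; rewrite chart0 mxE -mulrA [_ * (_ / _)]mulrC divfK //.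
  rewrite mxE /chart_slope !crd_coords //= !complex_eta -!E2.
  have c22 : Num.conj (g o2 o2) != 0.
    by rewrite fmorph_eq0; apply: contraTneq g22 => ->; rewrite ltxx.
  (* The third entry of the first column is forced by orthogonality to the last column, in which g22
     is nonzero. *)
  have := SU3_cols o2 o0 Sg; rewrite sum3 /= => /eqP; rewrite addr_eq0 => /eqP H.
  move: i; apply: ord3P => /=; [by rewrite mulr1|by field|].
  apply: (mulfI c22); rewrite -[LHS]opprK -H; field.
  exact/andP.
Qed.

End Chart.

(** * Continuity of the chart and of its inverse *)

Lemma cvg_mx (U : topologicalType) (T : Type) (F : set_system T) (FF : Filter F)
    m n (f : T -> 'M[U]_(m, n)) (M : 'M[U]_(m, n)) :
  (forall i j, (fun x => f x i j) @ F --> M i j) -> f @ F --> M.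
Proof.
move=> fM A [P PM PA]; apply: (filterS PA).
apply: (@filter_forall _ _ (fun i => [set x | forall j, P i j (f x i j)]) F FF) => i.
apply: (@filter_forall _ _ (fun j => [set x | P i j (f x i j)]) F FF) => j.
exact: fM (PM i j).
Qed.

Section ChartContinuity.
Variables (R : realType) (F : set_system 'rV[R]_7) (d : 'rV[R]_7).
Context {FF : Filter F}.
Hypothesis Fd : F --> d.
Local Notation C := (R[i])^o.

Lemma cvg_crd k : (fun x => crd x k) @ F --> crd d k.
Proof. exact: cvg_comp Fd (@coord_continuous R _ _ _ _ d). Qed.

Lemma cvg_radicand : @radicand R @ F --> radicand d.
Proof.
have sq k : (fun x => crd x k ^+ 2) @ F --> crd d k ^+ 2.
  exact: (@cvgM R _ _ _ _ _ _ _ (@cvg_crd k) (@cvg_crd k)).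
by apply: (@cvgB R R^o); [exact: cvg_cst|do 4![apply: (@cvgD R R^o) => //]].
Qed.

Lemma cvg_chart_w i : (fun x => chart_w x i 0 : C) @ F --> (chart_w d i 0 : C).
Proof.
rewrite mxE; under eq_fun do rewrite mxE.
move: i; apply: ord3P => /=; apply: cvg_complex; last exact: cvg_crd.
(* The fifth goal is the real part of the last entry, the square root; the others are
   coordinates. *)
5: exact: cvg_comp cvg_radicand (@sqrt_continuous R _).
all: exact: cvg_crd.
Qed.

Hypothesis d0 : chart_dom d.

Lemma cvg_chart_dir i :
  (fun x => chart_dir x i 0 : C) @ F --> (chart_dir d i 0 : C).
Proof.
rewrite mxE; under eq_fun do rewrite mxE.
have slope : (fun x => chart_slope x : C) @ F --> (chart_slope d : C).
  by apply: cvg_complex; exact: cvg_crd.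
have w k := cvg_conj (@cvg_chart_w k).
move: i; apply: ord3P => /=; [exact: cvg_cst|exact: slope|].
apply: (@cvgM R[i]); last first.
  apply: (@cvgV R[i]); last exact: w.
  by rewrite fmorph_eq0 chart_w2_neq0.
apply: (@cvgN R[i] C); apply: (@cvgD R[i] C); first exact: w.
by apply: (@cvgM R[i]); [exact: slope|exact: w].
Qed.

Lemma cvg_chart_nrm : (fun x => chart_nrm x : C) @ F --> (chart_nrm d : C).
Proof.
have sq k : (fun x => chart_dir x k 0 * Num.conj (chart_dir x k 0) : C) @ F
    --> (chart_dir d k 0 * Num.conj (chart_dir d k 0) : C).
  apply: (@cvgM R[i]); first exact: cvg_chart_dir.
  by apply: cvg_conj; exact: cvg_chart_dir.
have Re_cvg : (fun x => complex.Re (\sum_i chart_dir x i 0 * Num.conj (chart_dir x i 0)))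
    @ F --> complex.Re (\sum_i chart_dir d i 0 * Num.conj (chart_dir d i 0)).
  rewrite sum3; under eq_fun do rewrite sum3.
  apply: cvg_Re; apply: (@cvgD R[i] C); last exact: sq.
  by apply: (@cvgD R[i] C); exact: sq.
exact: cvg_real_complex (cvg_comp _ _ Re_cvg (@sqrt_continuous R _)).
Qed.

Lemma cvg_chart_v i : (fun x => chart_v x i 0 : C) @ F --> (chart_v d i 0 : C).
Proof.
rewrite mxE; under eq_fun do rewrite mxE.
apply: (@cvgM R[i]); first exact: cvg_chart_dir.
apply: (@cvgV R[i]); last exact: cvg_chart_nrm.
by case: (chart_dir_sqnorm d).
Qed.

Lemma cvg_chart : (fun x => chart x : 'M[C]_3) @ F --> (chart d : 'M[C]_3).
Proof.
apply: cvg_mx => i j; rewrite mxE; under eq_fun do rewrite mxE.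
have v k := @cvg_chart_v k; have w k := @cvg_chart_w k.
have vw k l : (fun x => chart_w x k 0 * chart_v x l 0 : C) @ F
    --> (chart_w d k 0 * chart_v d l 0 : C) by exact: (@cvgM R[i]).
have cr k : (fun x => cross (chart_v x) (chart_w x) k : C) @ F
    --> (cross (chart_v d) (chart_w d) k : C).
  rewrite /cross; move: k; apply: ord3P => /=.
  - by apply: (@cvgB R[i] C); exact: vw.
  - by apply: (@cvgB R[i] C); exact: vw.
  - by apply: (@cvgB R[i] C); exact: vw.
move: j; apply: ord3P => /=; [exact: v|exact: cvg_conj (cr i)|exact: w].
Qed.

End ChartContinuity.

Lemma cvg_mulmx (R : realType) (T : Type) (F : set_system T) (FF : Filter F)
    (f h : T -> 'M[(R[i])^o]_3) (A B : 'M[(R[i])^o]_3) :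
  f @ F --> A -> h @ F --> B ->
  (fun x => f x *m h x : 'M[(R[i])^o]_3) @ F --> (A *m B : 'M[(R[i])^o]_3).
Proof.
move=> fA hB; apply: cvg_mx => i j.
rewrite mxE sum3; under eq_fun do rewrite mxE sum3.
have e k : (fun x => f x i k * h x k j : (R[i])^o) @ F --> (A i k * B k j : (R[i])^o).
  apply: (@cvgM R[i]).
    exact: cvg_comp fA (@coord_continuous R[i] _ _ _ _ A).
  exact: cvg_comp hB (@coord_continuous R[i] _ _ _ _ B).
apply: (@cvgD R[i] (R[i])^o); last exact: e.
by apply: (@cvgD R[i] (R[i])^o); exact: e.
Qed.

Section CoordsContinuity.
Variables (R : realType).
Local Notation C := (R[i])^o.
Variables (F : set_system 'M[C]_3) (g : 'M[C]_3).
Context {FF : Filter F}.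
Hypothesis Fg : F --> g.

Lemma cvg_entry i j : (fun x : 'M[C]_3 => x i j) @ F --> g i j.
Proof. exact: cvg_comp Fg (@coord_continuous R[i] _ _ _ _ g). Qed.

Hypothesis g0 : coords_dom g.

Lemma cvg_coords : @coords R @ F --> coords g.
Proof.
apply: cvg_mx => i j; rewrite mxE; under eq_fun do rewrite mxE.
have e k l := @cvg_entry k l.
have q : (fun x : 'M[C]_3 => x o1 o0 / x o0 o0 : C) @ F --> (g o1 o0 / g o0 o0 : C).
  by apply: (@cvgM R[i]) => //; apply: (@cvgV R[i]) => //; case: g0.
case: j => [[|[|[|[|[|[|[|//]]]]]]] ?] /=.
- exact: cvg_Re (e _ _).
- exact: cvg_Im (e _ _).
- exact: cvg_Re (e _ _).
- exact: cvg_Im (e _ _).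
- exact: cvg_Im (e _ _).
- exact: cvg_Re q.
- exact: cvg_Im q.
Qed.

(** Openness of [coords_dom], phrased along a filter so that it can be pulled back along b |-> g^* b
    h. *)
Lemma near_coords_dom : \forall x \near F, coords_dom x.
Proof.
case: g0 => g22 g00.
have h2 : \forall x \near F, 0 < complex.Re ((x : 'M[C]_3) o2 o2).
  exact: (cvgr_gt _ (cvg_Re (@cvg_entry o2 o2)) _ g22).
have h0 : \forall x \near F, (x : 'M[C]_3) o0 o0 != 0.
  exact: (@cvgr_neq0 R[i] C _ _ _ _ _ (@cvg_entry o0 o0)).
by apply: filterS2 h2 h0 => x ? ?; split.
Qed.

End CoordsContinuity.

Lemma open_chart_dom (R : realType) : open (@chart_dom R).
Proof.
rewrite openE => d d0.
exact: (cvgr_gt _ (cvg_radicand (@cvg_id _ (nbhs d))) _ d0).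
Qed.

(** * Homogeneous spaces with stabilizer U1 *)

(** Transitivity is checked from one base point: if x = g p and y = h p, then h g^* carries x to
    y. *)
Lemma homogeneous_orbit (R : realType) (X : Type)
    (act : 'M[R[i]]_3 -> X -> X) (F : set X) (p : X) :
  F p ->
  (forall g x, SU3 g -> F x -> F (act g x)) ->
  (forall x, act 1 x = x) ->
  (forall g h x, act (g *m h) x = act g (act h x)) ->
  (forall x, F x -> exists2 g, SU3 g & act g p = x) ->
  homogeneous act F.
Proof.
move=> Fp actF act1 actM orb; split=> //; first by exists p.
move=> x y /orb[g Sg <-] /orb[h Sh <-]; exists (h *m adj g).
  by apply: SU3_mul => //; exact: SU3_adj.
by rewrite actM -[act (adj g) _]actM mul_adj_mx // act1.
Qed.

Section Dimension.
Variables (R : realType) (X : Type) (act : 'M[R[i]]_3 -> X -> X) (F : set X).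
Hypothesis homF : homogeneous act F.
Variable p : X.
Hypotheses (Fp : F p) (stab_p : stabilizer act p = U1).
Implicit Types a b : 'M[R[i]]_3.

Lemma act_eq a b : SU3 a -> SU3 b -> act a p = act b p ->
  exists2 u, U1 u & a = b *m u.
Proof.
case: homF => _ _ act1 actM _ Sa Sb ab; have Sb' := SU3_adj Sb.
exists (adj b *m a); last by rewrite mulmxA mulmx_adj // mul1mx.
rewrite -stab_p; split; first exact: SU3_mul.
by rewrite actM // ab -actM // mul_adj_mx // act1.
Qed.

Lemma act_U1 a u : SU3 a -> U1 u -> act (a *m u) p = act a p.
Proof.
case: homF => _ _ act1 actM _ Sa Uu; rewrite actM //; last exact: U1_SU3.
by move: Uu; rewrite -stab_p => -[_ ->].
Qed.

(** Describes the preimage of a chart image under the orbit map of [p] by conditions on matrix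
    entries, so that openness in the quotient becomes a matter of continuity of [coords]. *)
Lemma act_chartP g a (E : set 'rV[R]_7) : SU3 g -> SU3 a -> E `<=` @chart_dom R ->
  [set act (g *m chart d) p | d in E] (act a p) <->
  coords_dom (adj g *m a) /\ E (coords (adj g *m a)).
Proof.
move=> Sg Sa ED; have Sga : SU3 (adj g *m a) by apply: SU3_mul => //; exact: SU3_adj.
split=> [[d Ed]|[dom Ec]].
  have Sd := chart_SU3 (ED _ Ed).
  move=> /esym /(act_eq Sa (SU3_mul Sg Sd)) [u Uu ->].
  rewrite !mulmxA mul_adj_mx // mul1mx.
  have [? ->] := coords_U1 Uu (chart_coords_dom (ED _ Ed)).
  by rewrite chartK.
have [Dc [u Uu E1]] := coordsK Sga dom.
exists (coords (adj g *m a)) => //.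
have Sc := chart_SU3 Dc.
rewrite -(act_U1 (SU3_mul Sg Sc) Uu) -mulmxA -E1 mulmxA mulmx_adj //.
by rewrite mul1mx.
Qed.

Lemma homogeneous_dimension : has_dimension act F 7.
Proof.
have [_ actF act1 actM trans] := homF.
have dom0 : @chart_dom R 0.
  by rewrite /chart_dom /= /radicand /crd !mxE expr0n /= !addr0 subr0 ltr01.
have S0 := chart_SU3 dom0.
(* The chart is translated by [g] so that the point with coordinates 0 lands on [x]. *)
move=> x Fx; have [g Sg gx] := trans _ _ (actF _ _ S0 Fp) Fx.
have gS d : chart_dom d -> SU3 (g *m chart d).
  by move=> Dd; apply: SU3_mul Sg _; exact: chart_SU3.
have gF d : chart_dom d -> F (act (g *m chart d) p).
  by move=> Dd; apply: actF Fp; exact: gS.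
exists (@chart_dom R), (fun d => act (g *m chart d) p); split.
- exact: open_chart_dom.
- move=> d d' /set_mem Dd /set_mem Dd' dd'.
  have [Sd Sd'] := (chart_SU3 Dd, chart_SU3 Dd').
  have [u Uu] := act_eq (SU3_mul Sg Sd) (SU3_mul Sg Sd') dd'.
  move/(congr1 (mulmx (adj g))); rewrite !mulmxA mul_adj_mx // !mul1mx => E.
  have [_] := coords_U1 Uu (chart_coords_dom Dd').
  (* [coords] is constant on cosets of U1, hence separates the points of the chart. *)
  by rewrite -E !chartK.
- by move=> _ [d Dd <-]; exact: gF.
- by exists 0; rewrite // actM.
move=> E ED; split=> [oE|[EF orbE]].
  split; first by move=> _ [d /ED Dd <-]; exact: gF.
  move=> y Fy; have [h Sh hy] := trans _ _ Fp Fy.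
  (* Within SU3 this is the preimage of the chart image under the orbit map of y = h p, by
     [act_chartP]. It is defined, and open, in the whole matrix space. *)
  exists [set a | coords_dom (adj g *m a *m h) /\ E (coords (adj g *m a *m h))].
    rewrite openE => a [dom_a Ea].
    have lim : (fun b : 'M[(R[i])^o]_3 => adj g *m b *m h : 'M[(R[i])^o]_3) @ (nbhs a)
        --> (adj g *m a *m h : 'M[(R[i])^o]_3).
      apply: cvg_mulmx; last exact: cvg_cst.
      by apply: cvg_mulmx; [exact: cvg_cst|exact: cvg_id].
    apply: filterI; first exact: near_coords_dom lim dom_a.
    by apply: (cvg_coords lim dom_a); apply: open_nbhs_nbhs; split.
  apply/seteqP; split=> a [Oa Sa]; split => //.
    by rewrite /= -hy -actM //; apply/act_chartP; [| exact: SU3_mul | | rewrite mulmxA].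
  move: Oa; rewrite /= -hy -actM // -mulmxA; apply: (iffLR (act_chartP _ _ _)) => //.
  exact: SU3_mul.
(* Conversely, by [memE], inside [chart_dom] the set [E] is the preimage of the open set [W] under
   the continuous map d |-> g (chart d). *)
have [W Wo WE] := orbE _ Fp.
rewrite openE => d Ed; have Dd := ED _ Ed.
have memE e : chart_dom e -> W (g *m chart e) <-> E e.
  move=> De; have Se := gS _ De.
  transitivity ((W `&` SU3) (g *m chart e)); first by split => [|[]].
  rewrite WE; transitivity ([set act (g *m chart d) p | d in E] (act (g *m chart e) p)).
    by split => [[]|].
  rewrite act_chartP // mulmxA mul_adj_mx // mul1mx chartK.
  by split=> [[]//|]; split => //; exact: chart_coords_dom.
have lim : (fun d' => g *m chart d' : 'M[(R[i])^o]_3) @ (nbhs d)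
    --> (g *m chart d : 'M[(R[i])^o]_3).
  by apply: cvg_mulmx; [exact: cvg_cst|apply: cvg_chart => //; exact: cvg_id].
have nO : \forall d' \near d, W (g *m chart d').
  by apply: lim; apply: open_nbhs_nbhs; split => //; apply/memE.
have nD : \forall d' \near d, chart_dom d'.
  by apply: open_nbhs_nbhs; split => //; exact: open_chart_dom.
by apply: filterS2 nO nD => d' ? ?; apply/memE.
Qed.

End Dimension.

(** * Symmetric products U P U^T *)

Section FL3.
Variable R : realType.
Local Notation C := (R[i]).

Lemma act3_1 (Q : 'M[C]_3) : act3 1 Q = Q.
Proof. by rewrite /act3 trmx1 mulmx1 mul1mx. Qed.

Lemma act3M (g h Q : 'M[C]_3) : act3 (g *m h) Q = act3 g (act3 h Q).
Proof. by rewrite /act3 trmx_mul !mulmxA. Qed.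

Lemma FL3_P : FL3 (P R).
Proof. by exists 1%:M; [exact: SU3_1|rewrite trmx1 mulmx1 mul1mx]. Qed.

Lemma FL3_homogeneous : homogeneous (@act3 R) FL3.
Proof.
apply: (homogeneous_orbit FL3_P).
- move=> g _ Sg [U SU <-]; exists (g *m U); first exact: SU3_mul.
  by rewrite trmx_mul /act3 !mulmxA.
- exact: act3_1.
- exact: act3M.
- by move=> _ [U SU <-]; exists U.
Qed.

Lemma epsilon_cube : epsilon R ^+ 3 = -1.
Proof.
have -> : epsilon R ^+ 3 =
    cos (pi / 3 + pi / 3 + pi / 3) +i* sin (pi / 3 + pi / 3 + pi / 3).
  rewrite !(cosD, sinD) /epsilon exprS expr2; simpc.
  by apply/eqP; rewrite eq_complex /=; apply/andP; split; apply/eqP; ring.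
have -> : pi / 3 + pi / 3 + pi / 3 = pi :> R by field.
by rewrite cospi sinpi; apply/eqP; rewrite eq_complex /= oppr0 !eqxx.
Qed.

Lemma epsilon2_neq1 : epsilon R ^+ 2 != 1.
Proof.
(* If the square were 1, the cube would give epsilon = -1, whose imaginary part is 0, whereas sin
   (pi / 3) is positive. *)
apply/eqP => e2; have := epsilon_cube; rewrite exprSr e2 mul1r => /eqP.
rewrite eq_complex /= => /andP[_]; rewrite oppr0 => /eqP s0.
suff : 0 < sin (pi / 3 : R) by rewrite s0 ltxx.
by apply: sin_gt0_pi; have pi0 := pi_gt0 R; apply/andP; split; lra.
Qed.

Lemma act3_U1 (u : 'M[C]_3) : U1 u -> act3 u (P R) = P R.
Proof.
move=> /U1_entries[a a1 ->]; have a0 : a != 0 by rewrite -normr_gt0 a1.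
apply/matrixP; apply: ord3P; apply: ord3P; rewrite /act3 !mxE sum3 !mxE !sum3 !mxE /=.
all: by field.
Qed.

Lemma stabilizer_P : stabilizer (@act3 R) (P R) = U1.
Proof.
apply/seteqP; split=> [g [Sg gP]|u Uu]; last first.
  by split; [exact: U1_SU3|exact: act3_U1].
pose w := epsilon R ^+ 2.
have w3 : w ^+ 3 = 1 by rewrite /w -exprM mulnC exprM epsilon_cube sqrrN expr1n.
have w1 : w != 1 := epsilon2_neq1.
have w0 : w != 0 by apply: contra_eq_neq w3 => ->; rewrite expr0n /= eq_sym oner_eq0.
have e4 : epsilon R ^+ 4 = w ^+ 2 by rewrite -exprM.
(* g fixes both P and its transpose; as w != w^2, the two relations obtained
   entrywise from g Q = Q (conj g) kill the off-diagonal entries. *)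
have twist (Q : 'M[C]_3) : act3 g Q = Q -> g *m Q = Q *m (adj g)^T.
  by move=> {2}<-; rewrite /act3 -mulmxA -trmx_mul mul_adj_mx // trmx1 mulmx1.
have gPT : act3 g (P R)^T = (P R)^T.
  by rewrite -[in RHS]gP /act3 !trmx_mul trmxK mulmxA.
have E i j := congr1 (fun M : 'M[C]_3 => M i j) (twist _ gP).
have ET i j := congr1 (fun M : 'M[C]_3 => M i j) (twist _ gPT).
have fix0 (z : C) : w * z = z -> z = 0.
  move/eqP; rewrite -subr_eq0 -{2}[z]mul1r -mulrBl mulf_eq0 subr_eq0.
  by rewrite (negPf w1) => /eqP.
have conj0 (z : C) : Num.conj z = 0 -> z = 0.
  by move/eqP; rewrite fmorph_eq0 => /eqP.
have g01_10 : g o0 o1 = w * Num.conj (g o1 o0).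
  have := ET o0 o0; rewrite !mxE !sum3 !mxE /= -/w e4 !mulr0 !mul0r !addr0 !add0r => H.
  by apply: (mulIf w0); rewrite H; ring.
have g10 : g o1 o0 = 0.
  (* The relations g01 = w conj(g10) and w^2 g01 = w conj(g10), together with w^3 = 1, give
     conj(g10) = w conj(g10). *)
  apply: conj0; apply: fix0.
  have := E o0 o0; rewrite !mxE !sum3 !mxE /= -/w e4 !mulr0 !mul0r !addr0 !add0r.
  by rewrite g01_10 mulrAC -exprS w3 mul1r.
have g01 : g o0 o1 = 0 by rewrite g01_10 g10 rmorph0 mulr0.
have g02_w : g o0 o2 = w * Num.conj (g o1 o2).
  by have := E o0 o2; rewrite !mxE !sum3 !mxE /= !mulr0 !mul0r mulr1 !addr0 !add0r.
have g12 : g o1 o2 = 0.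
  apply: conj0; apply: fix0; apply: (mulfI w0).
  have := ET o0 o2; rewrite !mxE !sum3 !mxE /= -/w e4 !mulr0 !mul0r mulr1 !addr0 !add0r.
  by rewrite g02_w => H; rewrite mulrA -expr2 -H.
have g02 : g o0 o2 = 0 by rewrite g02_w g12 rmorph0 mulr0.
have g11 : Num.conj (g o1 o1) = g o0 o0.
  have := E o0 o1; rewrite !mxE !sum3 !mxE /= -/w !mulr0 !mul0r !addr0 !add0r mulrC.
  by move/(mulfI w0).
have g00 : g o0 o0 * Num.conj (g o0 o0) = 1.
  by have := SU3_rows o0 o0 Sg; rewrite sum3 g01 g02 !mul0r !addr0.
have g22 : g o2 o2 = 1.
  case: (Sg) => _; rewrite det3 g01 g02 g12 !mul0r !subr0 addr0 => <-.
  by rewrite mulrA -[g o1 o1]conjCK g11 g00 mul1r.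
exact: U1P.
Qed.

End FL3.

(** * The Hermitian product *)

Section HermitianProduct.
Variable R : realType.
Local Notation C := (R[i]).
Implicit Types (g : 'M[C]_3) (u v w : 'cV[C]_3).

Lemma hdotE u v : hdot u v = (map_mx Num.conj v^T *m u) 0 0.
Proof. by rewrite mxE; apply: eq_bigr => j _; rewrite !mxE mulrC. Qed.

(** Stated for unitary matrices, so as to cover also [basis0], whose determinant is i. *)
Lemma hdot_isometry g u v : adj g *m g = 1%:M -> hdot (g *m u) (g *m v) = hdot u v.
Proof.
move=> gK; rewrite !hdotE; congr (_ _ _).
transitivity (map_mx Num.conj v^T *m (adj g *m g) *m u); last by rewrite gK mulmx1.
by rewrite trmx_mul map_mxM !mulmxA.
Qed.

Lemma S5_act g v : SU3 g -> S5 v -> S5 (g *m v).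
Proof. by move=> Sg Sv; rewrite /S5 /= hdot_isometry // mul_adj_mx. Qed.

Lemma normalize v : v != 0 -> exists2 c : C, c != 0 & S5 (c *: v).
Proof.
move=> v0.
have S_ge0 : 0 <= hdot v v.
  by apply: sumr_ge0 => j _; rewrite -normCK exprn_ge0.
have S_neq0 : hdot v v != 0.
  apply: contra_neq v0 => /eqP; rewrite psumr_eq0 => [/allP S0|j _]; last first.
    by rewrite -normCK exprn_ge0.
  apply/colP => j; rewrite mxE; apply/eqP.
  have := S0 j; rewrite mem_index_enum => /(_ isT) /=.
  by rewrite -normCK sqrf_eq0 normr_eq0.
have c0 : 0 < sqrtC (hdot v v) by rewrite sqrtC_gt0 lt_def S_neq0.
exists (sqrtC (hdot v v))^-1; first by rewrite invr_eq0 gt_eqF.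
have cJ : Num.conj (sqrtC (hdot v v))^-1 = (sqrtC (hdot v v))^-1.
  by apply: conj_Creal; rewrite gtr0_real // invr_gt0.
rewrite /S5 /=; transitivity ((sqrtC (hdot v v)) ^- 2 * hdot v v).
  rewrite {4}/hdot mulr_sumr; apply: eq_bigr => j _.
  rewrite !mxE rmorphM [X in _ * (X * _)]cJ.
  by field; rewrite gt_eqF.
by rewrite sqrtCK mulVf.
Qed.

Lemma hdotBl u v w : hdot (u - v) w = hdot u w - hdot v w.
Proof. by rewrite /hdot -sumrB; apply: eq_bigr => j _; rewrite !mxE mulrBl. Qed.

Lemma hdotZl (k : C) u v : hdot (k *: u) v = k * hdot u v.
Proof. by rewrite /hdot mulr_sumr; apply: eq_bigr => j _; rewrite !mxE mulrA. Qed.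

Lemma S5_neq0 v : S5 v -> v != 0.
Proof.
apply: contraPneq => ->; rewrite /S5 /= -(scale0r 0) hdotZl mul0r => /esym/eqP.
by rewrite oner_eq0.
Qed.

Lemma S5_sum v : S5 v <-> \sum_i v i 0 * Num.conj (v i 0) = 1.
Proof. by []. Qed.

Definition e1 : 'cV[C]_3 := \col_j [:: 1; 0; 0]`_j.

Lemma mul_e1 (A : 'M[C]_3) i : (A *m e1) i 0 = A i o0.
Proof. by rewrite mxE sum3 !mxE /= !mulr0 !addr0 mulr1. Qed.

Lemma mul_e3 (A : 'M[C]_3) i : (A *m e3 R) i 0 = A i o2.
Proof. by rewrite mxE sum3 !mxE /= !mulr0 !add0r mulr1. Qed.

Lemma S5_e3 : S5 (e3 R).
Proof. by rewrite S5_sum sum3 !mxE /= !mul0r !add0r rmorph1 mulr1. Qed.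

Lemma frame_col v w :
  frame Num.conj v w *m e1 = v /\ frame Num.conj v w *m e3 R = w.
Proof.
split; apply/matrixP => i j; rewrite ord1 ?mul_e1 ?mul_e3 mxE //.
Qed.

Lemma frame_SU3 v w : S5 v -> S5 w -> hdot v w = 0 -> SU3 (frame Num.conj v w).
Proof.
move=> Sv Sw vw; split; last exact: (det_frame Sv Sw vw).
by apply/unitarymxP; apply: (frame_unitary _ Sv Sw vw); exact: conjCK.
Qed.

Lemma e3_fixed g : g *m e3 R = e3 R -> [/\ g o0 o2 = 0, g o1 o2 = 0 & g o2 o2 = 1].
Proof. by move=> gE; split; rewrite -mul_e3 gE mxE. Qed.

Lemma U1_e3 g : U1 g -> g *m e3 R = e3 R.
Proof.
move=> /U1_entries[a _ ->]; apply/colP; apply: ord3P; by rewrite mul_e3 !mxE.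
Qed.

End HermitianProduct.

(** * Flags *)

Section FL2.
Variable R : realType.
Local Notation C := (R[i]).
Local Notation mulv g := (linfun (mulmx g) : 'End('cV[C]_3)).
Implicit Types (g h u : 'M[C]_3).

Lemma limg_mulmx1 (U : {vspace 'cV[C]_3}) : (mulv (1 : 'M[C]_3) @: U)%VS = U.
Proof.
rewrite -[RHS]lim1g; congr (_ @: _)%VS; apply/lfunP => x.
by rewrite lfunE /= mul1mx id_lfunE.
Qed.

Lemma limg_mulmx g h (U : {vspace 'cV[C]_3}) :
  (mulv (g *m h) @: U = mulv g @: (mulv h @: U))%VS.
Proof.
rewrite -limg_comp; congr (_ @: _)%VS; apply/lfunP => x.
by rewrite comp_lfunE !lfunE /= mulmxA.
Qed.

Lemma limg_mulmx_dim g (U : {vspace 'cV[C]_3}) : SU3 g -> \dim (mulv g @: U) = \dim U.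
Proof.
move=> Sg; apply: limg_dim_eq; apply/eqP; rewrite -subv0; apply/subvP => x.
rewrite memv_cap memv_ker lfunE /= memv0 => /andP[_ /eqP gx].
by rewrite -[x]mul1mx -(mul_adj_mx Sg) -mulmxA gx mulmx0.
Qed.

Lemma limg_mulmx_line g (v : 'cV[C]_3) : (mulv g @: <[v]> = <[g *m v]>)%VS.
Proof. by rewrite limg_line lfunE. Qed.

Lemma act2_1 p : act2 (1 : 'M[C]_3) p = p.
Proof. by case: p => v [W1 W2 W3]; rewrite /act2 /flag_act /= mul1mx !limg_mulmx1. Qed.

Lemma act2M g h p : act2 (g *m h) p = act2 g (act2 h p).
Proof.
by case: p => v [W1 W2 W3]; rewrite /act2 /flag_act /= -mulmxA !limg_mulmx.
Qed.

Lemma limg_mulmx_full g : SU3 g -> (mulv g @: fullv)%VS = fullv.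
Proof. by move=> Sg; apply/eqP; rewrite eqEdim subvf limg_mulmx_dim //=. Qed.

Lemma line_scale (k : C) (v : 'cV[C]_3) : k != 0 -> (<[k *: v]> = <[v]>)%VS.
Proof.
move=> k0; apply/eqP; rewrite eqEdim -memvE memvZ ?memv_line //=.
by rewrite !dim_vline scaler_eq0 (negPf k0).
Qed.

Lemma FL2_act g p : SU3 g -> FL2 p -> FL2 (act2 g p).
Proof.
case: p => v [W1 W2 W3] Sg [/= Sv [/= W12 W23 W3E [d1 d2 d3]] W1E].
split => /=; first exact: S5_act; last by rewrite W1E limg_mulmx_line.
split => /=; [exact: limgS|exact: limgS| |by rewrite !limg_mulmx_dim].
by rewrite W3E limg_mulmx_full.
Qed.

Definition flag0 : flag R := Flag <[e3 R]> (<[e3 R]> + <[e1 R]>) fullv.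

Lemma dim_line_sum (w v : 'cV[C]_3) : w != 0 -> v \notin <[w]>%VS ->
  \dim (<[w]> + <[v]>) = 2%N.
Proof.
move=> w0 vw; have v0 : v != 0 by apply: contraNneq vw => ->; rewrite mem0v.
rewrite dimv_disjoint_sum ?dim_vline ?w0 ?v0 //; apply/eqP; rewrite -subv0.
apply/subvP => x; rewrite memv_cap => /andP[xw /vlineP[k xv]].
rewrite memv0 xv scaler_eq0 (negPf v0) orbF; apply: contraNT vw => k0.
by rewrite -[v](scalerK k0) -xv memvZ.
Qed.

Lemma FL2_base : FL2 (e3 R, flag0).
Proof.
split => /=; [exact: S5_e3| |by []].
split => /=; [exact: addvSl|exact: subvf|by []|].
split; [by rewrite dim_vline (S5_neq0 (@S5_e3 R))| |by rewrite dimvf].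
apply: dim_line_sum; first exact: S5_neq0 (@S5_e3 R).
apply/vlineP => -[k /(congr1 (fun z : 'cV[C]_3 => z o0 0))] /eqP.
by rewrite !mxE /= mulr0 oner_eq0.
Qed.

(** Gram-Schmidt: a vector of W2 outside W1 is made orthogonal to [w] and normalized, and the frame
    with this first column and last column [w] carries the base flag to the given one. *)
Lemma FL2_orbit p : FL2 p -> exists2 g, SU3 g & act2 g (e3 R, flag0) = p.
Proof.
case: p => w [W1 W2 W3] [/= Sw [/= W12 W23 W3E [d1 d2 d3]] W1E].
have [x xW2 xW1] : exists2 x, x \in W2 & x \notin W1.
  apply/subvPn; apply: contra_eqN d2 => /dimvS; rewrite d1.
  by case: (\dim _) => [|[]].
pose y := x - hdot x w *: w.
have xE : x = y + hdot x w *: w by rewrite subrK.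
have yW1 : y \notin W1.
  apply: contra xW1 => yW1; rewrite xE memvD // W1E memvZ //; exact: memv_line.
have y0 : y != 0 by apply: contraNneq yW1 => ->; rewrite mem0v.
have [c c0 Sv] := normalize y0.
have vw : hdot (c *: y) w = 0.
  by rewrite hdotZl hdotBl hdotZl [hdot w w]Sw mulr1 subrr mulr0.
have Sg := frame_SU3 Sv Sw vw; have [g1 g3] := frame_col (c *: y) w.
exists (frame Num.conj (c *: y) w) => //.
rewrite /act2 /flag_act /= limgD !limg_mulmx_line g1 g3; congr (_, Flag _ _ _).
- by rewrite W1E.
- have cyW1 : c *: y \notin W1.
    by apply: contra yW1 => /(memvZ c^-1); rewrite scalerK.
  apply/eqP; rewrite eqEdim d2 dim_line_sum ?S5_neq0 -?W1E // leqnn andbT.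
  rewrite subv_add W12 -memvE memvZ // /y memvB // memvZ //.
  by apply: (subvP W12); rewrite W1E memv_line.
- by rewrite limg_mulmx_full // W3E.
Qed.

Lemma FL2_homogeneous : homogeneous (@act2 R) FL2.
Proof.
exact: (homogeneous_orbit FL2_base FL2_act act2_1 act2M FL2_orbit).
Qed.

(** Fixing e3 prescribes the last column, and preserving the span of e3 and e1 gives g10 = 0; these
    are the hypotheses of [U1P]. *)
Lemma stabilizer_flag0 : stabilizer (@act2 R) (e3 R, flag0) = U1.
Proof.
apply/seteqP; split=> [g [Sg [ge3 _]]|u Uu]; last first.
  split; first exact: U1_SU3.
  rewrite /act2 /flag_act /= limgD !limg_mulmx_line U1_e3 //.
  rewrite limg_mulmx_full; last exact: U1_SU3.
  case/U1_entries: Uu => a a1 ->; set u' := \matrix_(i, j) _.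
  have -> : u' *m e1 R = a *: e1 R.
    by apply/colP; apply: ord3P; rewrite mul_e1 !mxE /= ?mulr1 ?mulr0.
  by rewrite line_scale // -normr_gt0 a1.
rewrite limgD !limg_mulmx_line ge3 => W2E _.
have [g02 g12 g22] := e3_fixed ge3.
apply: U1P => //.
have : g *m e1 R \in (<[e3 R]> + <[e1 R]>)%VS.
  by rewrite -W2E; apply: (subvP (addvSr _ _)); exact: memv_line.
case/memv_addP => x /vlineP[k ->] [y /vlineP[l ->]].
move/(congr1 (fun z : 'cV[C]_3 => z o1 0)).
by rewrite mul_e1 !mxE /= !mulr0 addr0.
Qed.

End FL2.

(** * Oriented Lagrangian subspaces *)

Section FL1.
Variable R : realType.
Local Notation C := (R[i]).
Local Notation toC := (map_mx (real_complex R)).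
Implicit Types (g h : 'M[C]_3).

Lemma oact1 (V : oriented_subspace R) : oact 1 V = V.
Proof.
case: V => W F; congr OrientedSubspace; apply/seteqP; split=> x /=.
- by move=> [y Wy <-]; rewrite mul1mx.
- by move=> Wx; exists x; rewrite ?mul1mx.
- by move=> [y Wy <-]; rewrite mul1mx.
- by move=> Wx; exists x; rewrite ?mul1mx.
Qed.

Lemma oactM g h (V : oriented_subspace R) : oact (g *m h) V = oact g (oact h V).
Proof.
congr OrientedSubspace; apply/seteqP; split=> x /=.
- by move=> [y Wy <-]; exists (h *m y); [exists y|rewrite mulmxA].
- by move=> [_ [y Wy <-] <-]; exists y; rewrite ?mulmxA.
- by move=> [y Wy <-]; exists (h *m y); [exists y|rewrite mulmxA].
- by move=> [_ [y Wy <-] <-]; exists y; rewrite ?mulmxA.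
Qed.

Lemma oact_span g (B : 'M[C]_3) : oact g (oriented_span B) = oriented_span (g *m B).
Proof.
congr OrientedSubspace; apply/seteqP; split=> x /=.
- by move=> [_ [c _ <-] <-]; exists c; rewrite ?mulmxA.
- by move=> [c _ <-]; exists (B *m toC c); [exists c|rewrite mulmxA].
- by move=> [_ [A A0 <-] <-]; exists A; rewrite ?mulmxA.
- by move=> [A A0 <-]; exists (B *m toC A); [exists A|rewrite mulmxA].
Qed.

Lemma oriented_span_basis (B : 'M[C]_3) (A : 'M[R]_3) :
  0 < \det A -> oriented_span (B *m toC A) = oriented_span B.
Proof.
move=> A0; have Au : A \in unitmx by rewrite unitmxE unitfE gt_eqF.
congr OrientedSubspace; apply/seteqP; split=> x /=.
- by move=> [c _ <-]; exists (A *m c); rewrite // map_mxM mulmxA.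
- move=> [c _ <-]; exists (invmx A *m c) => //.
  by rewrite -mulmxA -map_mxM mulKVmx.
- move=> [M M0 <-]; exists (A *m M); last by rewrite map_mxM mulmxA.
  by rewrite /= det_mulmx mulr_gt0.
- move=> [M M0 <-]; exists (invmx A *m M); last by rewrite -mulmxA -map_mxM mulKVmx.
  by rewrite /= det_mulmx det_inv mulr_gt0 // invr_gt0.
Qed.

Definition basis0 : 'M[C]_3 := \matrix_(j, k) [:: te1 R; te2 R; e3 R]`_k j 0.

Lemma basis0_unitary : adj basis0 *m basis0 = 1%:M.
Proof.
apply/matrixP; apply: ord3P; apply: ord3P; rewrite !mxE sum3 !mxE /= ?mxE /=.
all: apply/eqP; rewrite eq_complex /=; apply/andP; split; apply/eqP.
all: by field.
Qed.

Lemma basis0_unitaryr : basis0 *m adj basis0 = 1%:M.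
Proof. exact: mulmx1C basis0_unitary. Qed.

Lemma basis0_e3 : basis0 *m e3 R = e3 R.
Proof. by apply/colP; apply: ord3P; rewrite mul_e3 !mxE. Qed.

Lemma toC_e3 : e3 R = toC (\col_j [:: 0; 0; 1]`_j).
Proof. by apply/colP; apply: ord3P; rewrite !mxE. Qed.

Lemma toC_hdot (c d : 'cV[R]_3) : hdot (toC c) (toC d) = (\sum_j c j 0 * d j 0)%:C.
Proof.
rewrite /hdot rmorph_sum; apply: eq_bigr => j _; rewrite !mxE rmorphM /=.
by congr (_ * _); exact: conjc_real.
Qed.

Lemma real_free_mul g (B : 'M[C]_3) : SU3 g -> real_free B -> real_free (g *m B).
Proof.
move=> Sg Bf c d /(congr1 (mulmx (adj g))).
by rewrite -!mulmxA !(mulmxA (adj g)) mul_adj_mx // !mul1mx => /Bf.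
Qed.

Lemma oriented_lagrangian_act g (V : oriented_subspace R) :
  SU3 g -> oriented_lagrangian V -> oriented_lagrangian (oact g V).
Proof.
move=> Sg [[B Bf ->] lag]; split.
  by exists (g *m B); [exact: real_free_mul|exact: oact_span].
move=> _ _ [u Vu <-] [v Vv <-].
by rewrite hdot_isometry ?mul_adj_mx //; exact: lag.
Qed.

Lemma oriented_lagrangian_V0 : oriented_lagrangian (V0 R).
Proof.
split.
  exists basis0 => // c d /(congr1 (mulmx (adj basis0))).
  by rewrite !mulmxA basis0_unitary !mul1mx => /map_mx_inj -> //; exact: complexI.
move=> _ _ [c _ <-] [d _ <-].
by rewrite (hdot_isometry _ _ basis0_unitary) toC_hdot.
Qed.

Lemma FL1_base : FL1 (e3 R, V0 R).
Proof.
split => /=; first exact: S5_e3.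
  by exists (\col_j [:: 0; 0; 1]`_j) => //; rewrite -toC_e3 basis0_e3.
split; first exact: oriented_lagrangian_V0.
by exists 1%:M; [exact: SU3_1|rewrite oact1].
Qed.

Lemma act1_1 p : @act1 R 1 p = p.
Proof. by case: p => v V; rewrite /act1 mul1mx oact1. Qed.

Lemma act1M g h p : act1 (g *m h) p = act1 g (act1 h p).
Proof. by case: p => v V; rewrite /act1 /= -mulmxA oactM. Qed.

Lemma FL1_act g p : SU3 g -> FL1 p -> FL1 (act1 g p).
Proof.
case: p => v V Sg [/= Sv Vv [lagV [h Sh VE]]]; split => /=.
- exact: S5_act.
- by exists v.
- split; first exact: oriented_lagrangian_act.
  by exists (g *m h); [exact: SU3_mul|rewrite VE oactM].
Qed.

(** SO3 is transitive on the real unit sphere; a unit vector orthogonal to [c] completes it to a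
    rotation through [frame]. *)
Lemma real_frame (c : 'cV[R]_3) : \sum_j c j 0 * c j 0 = 1 ->
  exists A : 'M[R]_3, [/\ \det A = 1, A *m A^T = 1%:M &
    A *m (\col_j [:: 0; 0; 1]`_j) = c].
Proof.
move=> c1.
suff [a a1 ac] : exists2 a : 'cV[R]_3, \sum_j a j 0 * a j 0 = 1 &
    \sum_j a j 0 * c j 0 = 0.
  pose id_R : {rmorphism R -> R} := idfun.
  exists (frame id_R a c); split.
  - exact: (@det_frame _ id_R _ _ a1 c1 ac).
  - have := @frame_unitary _ id_R _ _ (fun=> erefl) a1 c1 ac.
    by rewrite map_mx_id.
  - by apply/colP => i; rewrite mxE sum3 !mxE /= !mulr0 !add0r mulr1.
pose n := c o0 0 ^+ 2 + c o1 0 ^+ 2.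
have n_ge0 : 0 <= n by rewrite addr_ge0 ?sqr_ge0.
have [n0|n0] := eqVneq n 0.
  have /andP[/eqP c0 /eqP _] : (c o0 0 == 0) && (c o1 0 == 0).
    by move/eqP: n0; rewrite paddr_eq0 ?sqr_ge0 // !sqrf_eq0.
  exists (\col_j [:: 1; 0; 0]`_j); rewrite sum3 !mxE /=.
    by rewrite !mulr0 !addr0 mulr1.
  by rewrite c0 !mul0r mulr0 !addr0.
have s0 : Num.sqrt n != 0 by rewrite gt_eqF // sqrtr_gt0 lt_def n0.
have sn : Num.sqrt n ^+ 2 = n by rewrite sqr_sqrtr.
(* A quarter turn of the horizontal part of [c], normalized; the case of a vertical [c] was settled
   above. *)
exists (\col_j [:: - c o1 0 / Num.sqrt n; c o0 0 / Num.sqrt n; 0]`_j);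
  rewrite sum3 !mxE /=.
  transitivity (n / Num.sqrt n ^+ 2); first by rewrite /n; field.
  by rewrite sn divff.
by field.
Qed.

(** Write v = g b c with b = [basis0] and c a real unit vector. If the rotation A takes e3 to c,
    then b A b^* lies in SU3, preserves the oriented subspace V0 and takes e3 to b c, so g b A b^*
    carries the base point to (v, V). *)
Lemma FL1_orbit p : FL1 p -> exists2 g, SU3 g & act1 g (e3 R, V0 R) = p.
Proof.
case: p => v V [/= Sv Vv [_ [g Sg VE]]].
move: Vv; rewrite VE => -[_ [c _ <-] gv].
have c1 : \sum_j c j 0 * c j 0 = 1.
  apply: complexI; rewrite -toC_hdot -(hdot_isometry _ _ basis0_unitary).
  by rewrite -(hdot_isometry _ _ (mul_adj_mx Sg)) gv.
have [A [A1 AT Ac]] := real_frame c1.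
have Ah : adj (toC A) = toC A^T.
  by apply/matrixP => i j; rewrite !mxE; exact: conjc_real.
have Sh : SU3 (basis0 *m toC A *m adj basis0).
  apply: SU3I.
    rewrite !adjM adjK Ah -!mulmxA (mulmxA (adj basis0)) basis0_unitary mul1mx.
    by rewrite (mulmxA (toC A)) -map_mxM AT map_mx1 mul1mx basis0_unitaryr.
  rewrite !det_mulmx mulrAC -det_mulmx basis0_unitaryr det1 mul1r det_map_mx A1.
  exact: rmorph1.
exists (g *m (basis0 *m toC A *m adj basis0)); first exact: SU3_mul.
have b3 : adj basis0 *m e3 R = e3 R by rewrite -{1}basis0_e3 mulmxA basis0_unitary mul1mx.
congr (_, _) => /=.
  by rewrite -!mulmxA b3 toC_e3 -map_mxM Ac -gv.
rewrite oactM; congr (oact g _); rewrite oact_span -mulmxA basis0_unitary mulmx1.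
by apply: oriented_span_basis; rewrite A1 ltr01.
Qed.

Lemma FL1_homogeneous : homogeneous (@act1 R) FL1.
Proof.
exact: (homogeneous_orbit FL1_base FL1_act act1_1 act1M FL1_orbit).
Qed.

Lemma carrier_V0 x : carrier (V0 R) x -> x o1 0 = Num.conj (x o0 0).
Proof.
move=> [c _ <-]; rewrite !mxE !sum3 !mxE /= ?mxE /=.
by apply/eqP; rewrite eq_complex /=; apply/andP; split; apply/eqP; ring.
Qed.

(** This vector and that of [V0_imag] are the sum and the difference of the first two basis vectors;
    [stabilizer_V0] tests the invariance of V0 on them. *)
Lemma V0_real : carrier (V0 R) (\col_j [:: 1; 1; 0]`_j).
Proof.
exists (\col_j [:: 1; 1; 0]`_j) => //; apply/colP; apply: ord3P.
all: rewrite !mxE sum3 !mxE /= ?mxE /=.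
all: apply/eqP; rewrite eq_complex /=; apply/andP; split; apply/eqP.
all: by field.
Qed.

Lemma V0_imag : carrier (V0 R) (\col_j [:: 0 +i* 1; 0 -i* 1; 0]`_j).
Proof.
exists (\col_j [:: 1; -1; 0]`_j) => //; apply/colP; apply: ord3P.
all: rewrite !mxE sum3 !mxE /= ?mxE /=.
all: apply/eqP; rewrite eq_complex /=; apply/andP; split; apply/eqP.
all: by field.
Qed.

(** In the basis [te1], [te2], [e3] the matrix diag(a, a^-1, 1) is a real rotation about e3, so it
    preserves both the span and the orientation. *)
Lemma oact_V0_U1 (u : 'M[C]_3) : U1 u -> oact u (V0 R) = V0 R.
Proof.
move=> /U1_entries[a a1 ->].
have aV : a^-1 = Num.conj a.
  have a0 : a != 0 by rewrite -normr_gt0 a1.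
  by apply: (mulfI a0); rewrite divff // -normCK a1 expr1n.
pose A : 'M[R]_3 := \matrix_(i, j) (nth [::]
  [:: [:: complex.Re a; complex.Im a; 0];
      [:: - complex.Im a; complex.Re a; 0]; [:: 0; 0; 1]] i)`_j.
have A1 : \det A = 1.
  have aa : complex.Re a ^+ 2 + complex.Im a ^+ 2 = 1.
    by apply: complexI; rewrite add_Re2_Im2 a1 expr1n.
  by rewrite -aa det3 !mxE /=; ring.
transitivity (oriented_span (basis0 *m toC A)); last first.
  by apply: oriented_span_basis; rewrite A1 ltr01.
rewrite oact_span; congr oriented_span.
apply/matrixP; apply: ord3P; apply: ord3P; rewrite !mxE !sum3 !mxE /= ?mxE /= ?aV.
all: case: (a) => x y; apply/eqP; rewrite eq_complex /=; apply/andP; split; apply/eqP.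
all: by ring.
Qed.

(** Elements of V0 have conjugate first two entries, so the upper left block of [g] has rows (a, b)
    and (conj b, conj a). The first row gives |a|^2 + |b|^2 = 1 and the determinant gives |a|^2 -
    |b|^2 = 1, hence b = 0. *)
Lemma stabilizer_V0 : stabilizer (@act1 R) (e3 R, V0 R) = U1.
Proof.
apply/seteqP; split=> [g [Sg [ge3 gW _]]|u Uu]; last first.
  by split; [exact: U1_SU3|rewrite /act1 /= U1_e3 // oact_V0_U1].
have [g02 g12 g22] := e3_fixed ge3.
have gV x : carrier (V0 R) x -> (g *m x) o1 0 = Num.conj ((g *m x) o0 0).
  by move=> Vx; apply: carrier_V0; rewrite -[carrier _]gW; exists x.
have [g10 g11] : g o1 o0 = Num.conj (g o0 o1) /\ g o1 o1 = Num.conj (g o0 o0).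
  have := gV _ V0_real; have := gV _ V0_imag; rewrite !mxE !sum3 !mxE /=.
  case: (g o0 o0) (g o0 o1) (g o1 o0) (g o1 o1) => [a a'] [b b'] [c c'] [d d'].
  rewrite !mulr0 !addr0 !mulr1 => /eqP; rewrite eq_complex /= => /andP[/eqP h1 /eqP h2].
  move=> /eqP; rewrite eq_complex /= => /andP[/eqP h3 /eqP h4].
  by split; apply/eqP; rewrite eq_complex /=; apply/andP; split; apply/eqP; lra.
have row0 : g o0 o0 * Num.conj (g o0 o0) + g o0 o1 * Num.conj (g o0 o1) = 1.
  by have := SU3_rows o0 o0 Sg; rewrite sum3 g02 mul0r addr0.
have det1 : g o0 o0 * Num.conj (g o0 o0) - g o0 o1 * Num.conj (g o0 o1) = 1.
  by case: (Sg) => _ <-; rewrite det3 g02 g12 g22 g10 g11; ring.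
have g01 : g o0 o1 = 0.
  have [] // := @sqnorm_sum_eq0 _ (g o0 o1) (g o0 o1).
  by apply: (addrI (g o0 o0 * Num.conj (g o0 o0) - g o0 o1 * Num.conj (g o0 o1)));
    rewrite addr0 {2}det1 -row0; ring.
by apply: U1P => //; rewrite g10 g01 rmorph0.
Qed.

End FL1.

Theorem theorem3p3 (R : realType) :
  [/\ homogeneous (@act1 R) FL1,
      homogeneous (@act2 R) FL2 &
      homogeneous (@act3 R) FL3] /\
  [/\ (exists2 p, FL1 p & stabilizer (@act1 R) p = U1)
        /\ has_dimension (@act1 R) FL1 7,
      (exists2 p, FL2 p & stabilizer (@act2 R) p = U1)
        /\ has_dimension (@act2 R) FL2 7 &
      (exists2 Q, FL3 Q & stabilizer (@act3 R) Q = U1)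
        /\ has_dimension (@act3 R) FL3 7].
Proof.
have hom1 := @FL1_homogeneous R; have hom2 := @FL2_homogeneous R.
have hom3 := @FL3_homogeneous R.
have stab1 := @stabilizer_V0 R; have stab2 := @stabilizer_flag0 R.
have stab3 := @stabilizer_P R.
have base1 := @FL1_base R; have base2 := @FL2_base R; have base3 := @FL3_P R.
split=> //; split; split.
- by exists (e3 R, V0 R).
- exact (homogeneous_dimension hom1 base1 stab1).
- by exists (e3 R, flag0 R).
- exact (homogeneous_dimension hom2 base2 stab2).
- by exists (P R).
- exact (homogeneous_dimension hom3 base3 stab3).
Qed.
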